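(* Let $d\geq 6$ and $k>1$ be integers. There does not exist any $(d,k)$-digraph with self-repeats if either $k$ is odd and $k\geq 2(d-1)$, or $k$ is even and $k\geq 2(d-1)^2$.
   Context: All digraphs are finite, without loops or multiple arcs. A digraph is diregular of degree $d$ if every vertex has in-degree and out-degree $d$. A $(d,k)$-digraph (almost Moore digraph) is a diregular digraph of degree $d>1$, diameter $k>1$ and order $N=d+d^2+\cdots+d^k$. In such a digraph every vertex $v$ has a unique vertex $r(v)$, called the repeat of $v$, such that there are exactly two walks of length $\leq k$ from $v$ to $r(v)$, at least one of them of length $k$. A vertex $v$ is a self-repeat if $r(v)=v$; the digraph ''has self-repeats'' if it has at least one self-repeat. *)

(* Defs.v *)
From mathcomp Require Import all_boot.

Set Implicit Arguments.
Unset Strict Implicit.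
Unset Printing Implicit Defensive.

(* A digraph on a finite vertex set T is its adjacency relation e : rel T;
   multiple arcs are excluded by this encoding, loops by [irreflexive e]. *)

Section Digraph.
Variables (T : finType) (e : rel T).

(* A walk of length l starting at u is given by its l vertices after u. *)
Definition walk (u v : T) (l : nat) (p : l.-tuple T) : bool :=
  path e u p && (last u p == v).

Definition num_walks (l : nat) (u v : T) : nat :=
  #|[set p : l.-tuple T | walk u v p]|.

Definition outdeg (u : T) : nat := #|[set v | e u v]|.
Definition indeg (u : T) : nat := #|[set v | e v u]|.

Definition diregular (d : nat) : Prop :=
  forall u, outdeg u = d /\ indeg u = d.

Definition is_dist (u v : T) (l : nat) : Prop :=
  (exists p : l.-tuple T, walk u v p) /\
  (forall m (p : m.-tuple T), walk u v p -> l <= m).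

Definition has_diameter (k : nat) : Prop :=
  (forall u v, exists2 l, is_dist u v l & l <= k) /\
  (exists u v, is_dist u v k).

Definition almost_moore (d k : nat) : Prop :=
  [/\ 1 < d /\ 1 < k, irreflexive e, diregular d, has_diameter k
    & #|T| = \sum_(1 <= i < k.+1) d ^ i].

(* [is_repeat k v w] says that w = r(v). The trivial walk of length 0 is
   counted, so v is its own repeat when exactly one closed walk of positive
   length <= k passes through v, and that walk has length k. *)
Definition is_repeat (k : nat) (v w : T) : Prop :=
  \sum_(0 <= l < k.+1) num_walks l v w = 2 /\ 0 < num_walks k v w.

Definition self_repeat (k : nat) (v : T) : Prop := is_repeat k v v.

Definition has_self_repeats (k : nat) : Prop := exists v, self_repeat k v.

End Digraph.

(* Main.v *)
Require Import Defs.
From mathcomp Require Import all_boot all_algebra all_fingroup.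
From mathcomp Require Import zify.

(** Let A be the adjacency matrix. Counting gives I + A + ... + A^k = J + P,
    where J is the all-one matrix and P is the permutation matrix of the repeat
    map r; hence A P = P A, so r is an automorphism. Let z be a self-repeat.
    For every p, the vertices fixed by r^p induce a digraph that is regular of
    some degree c and has c + ... + c^k vertices. Its quotient by r has an
    adjacency matrix M such that tr M^l - c^l is periodic in l with period k;
    since tr M^(q l) = tr M^l mod q for every prime q, this difference depends
    only on gcd(l, k). If l < k and l p <= k then tr M^l = 0, for otherwise some
    vertex would lie on a closed walk that is too short. Hence c > 1 forces
    every such l to divide k.
    For p = 1 and l = k - 1 this gives c = 1, so z has an out-neighbour that
    is not fixed by r; let p <= d - 1 be its period, so that c > 1 for this p.
    When k is odd, l = 2 gives a contradiction; when k is even, L = k %/ p and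
    L - 1 both divide k, whence L (L - 1) <= k, which is too large. *)

Set Implicit Arguments.
Unset Strict Implicit.
Unset Printing Implicit Defensive.

Import GRing.Theory.

(** * Traces of prime powers of matrices *)

Section PrimeCharacteristic.
Local Open Scope ring_scope.

Lemma detX (R : comNzRingType) n (M : 'M[R]_n) m :
  \det (M ^+ m) = (\det M) ^+ m.
Proof.
elim: m => [|m IHm]; first by rewrite !expr0 det1.
by rewrite !exprS det_mulmx IHm.
Qed.

Variables (R : comNzRingType) (p : nat) (pcharRp : p \in [pchar R]).
Local Notation Frob := (pFrobenius_aut pcharRp).

Let p_gt0 : (0 < p)%N.
Proof. by rewrite prime_gt0 // (pcharf_prime pcharRp). Qed.

Lemma exp_pchar_poly (f : {poly R}) : f ^+ p = map_poly Frob f \Po 'X^p.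
Proof.
have pcharRXp : p \in [pchar {poly R}] by rewrite pchar_poly.
rewrite -(pFrobenius_autE pcharRXp).
elim/poly_ind: f => [|f c IHf]; first by rewrite rmorph0 map_poly0 comp_poly0.
rewrite rmorphD rmorphM /= IHf [map_poly _ (_ + _)]rmorphD rmorphM /= map_polyX.
rewrite map_polyC comp_polyD comp_polyM comp_polyX comp_polyC.
by rewrite !pFrobenius_autE -rmorphXn.
Qed.

Lemma char_poly_exp_pchar n (M : 'M[R]_n.+1) :
  char_poly (M ^+ p) = map_poly Frob (char_poly M).
Proof.
have pcharMp : p \in [pchar 'M[{poly R}]_n.+1].
  rewrite inE (pcharf_prime pcharRp) /= -(rmorph_nat (@scalar_mx _ n.+1)).
  by rewrite -(rmorph_nat (@polyC R)) (pcharf0 pcharRp) !rmorph0.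
have char_poly_mx_exp :
    char_poly_mx M ^+ p = map_mx (comp_poly 'X^p) (char_poly_mx (M ^+ p)).
  rewrite /char_poly_mx -(pFrobenius_autE pcharMp).
  rewrite pFrobenius_autB_comm; last exact: comm_scalar_mx.
  rewrite !pFrobenius_autE map_mxB map_scalar_mx /= comp_polyX.
  rewrite -!rmorphXn /=; congr (_ - _).
  by apply/matrixP => i j; rewrite !mxE comp_polyC.
have comp_Xp :
    map_poly Frob (char_poly M) \Po 'X^p = char_poly (M ^+ p) \Po 'X^p.
  by rewrite -exp_pchar_poly /char_poly -det_map_mx -char_poly_mx_exp detX.
apply/polyP => i; move/polyP/(_ (i * p)%N): comp_Xp.
by rewrite !coef_comp_poly_Xn // dvdn_mull // mulnK.
Qed.

Lemma mxtrace_exp_pchar n (M : 'M[R]_n) : \tr (M ^+ p) = (\tr M) ^+ p.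
Proof.
case: n M => [|n] M; first by rewrite !flatmx0 mxtrace0 expr0n eqn0Ngt p_gt0.
apply: oppr_inj; rewrite -char_poly_trace // char_poly_exp_pchar coef_map.
by rewrite char_poly_trace //= pFrobenius_autN.
Qed.

End PrimeCharacteristic.

Lemma natr_Fp_eqmod q (a b : nat) : prime q ->
  (a%:R = b%:R :> 'F_q)%R <-> a = b %[mod q].
Proof.
move=> q_pr; split=> [ab | ab]; first by rewrite -!val_Fp_nat // ab.
by rewrite -(Fp_nat_mod q_pr a) ab Fp_nat_mod.
Qed.

Lemma mxtrace_exp_prime n (M : 'M[nat]_n) q : prime q ->
  (\tr (M ^+ q))%R = (\tr M)%R %[mod q].
Proof.
move=> q_pr; rewrite -(fermat_little (\tr M)%R q_pr).
apply/natr_Fp_eqmod => //; rewrite natrX.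
rewrite -!(trace_map_mx (GRing.natmul 1%R : {rmorphism nat -> 'F_q})).
by rewrite rmorphXn /= (mxtrace_exp_pchar (pchar_Fp q_pr)).
Qed.

(** * Periodic integer sequences and short divisors *)

Lemma window_sum_periodic (V : zmodType) (u : nat -> V) k :
  (forall m, \sum_(i < k) u (m + i.+1)%N = 0)%R ->
  forall m, 0 < m -> u (m + k) = u m.
Proof.
move=> window0 [|m] // _; apply: (addrI (\sum_(i < k) u (m + i.+1)%N)%R).
rewrite {2}window0 add0r addSnnS -(big_ord_recr k (fun i => u (m + i.+1))) /=.
rewrite big_ord_recl addn1 -[RHS]addr0 -[in RHS](window0 m.+1).
by congr (_ + _)%R; apply: eq_bigr => i _; rewrite addnS.
Qed.

Lemma exists_rough_addn a b B : 0 < a -> coprime a b ->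
  exists t, forall q, prime q -> q %| a + b * t -> B < q.
Proof.
move=> a_gt0 cop_ab; exists (B`!`_(\pi(a))^') => q q_pr q_dvd.
rewrite ltnNge; apply/negP => qB.
have q_dvd_fact : q %| B`! by rewrite dvdn_fact // prime_gt0.
have q_dvd_part : (q %| B`!`_(\pi(a))^') = ~~ (q %| a).
  have := pi_of_part (\pi(a))^' (fact_gt0 B) q.
  by rewrite !inE /= !mem_primes part_gt0 fact_gt0 q_pr q_dvd_fact a_gt0.
case: (boolP (q %| a)) q_dvd_part => qa q_part; last first.
  by move: q_dvd; rewrite dvdn_addl ?(negPf qa) // dvdn_mull.
move: q_dvd; rewrite dvdn_addr // Euclid_dvdM // q_part orbF => qb.
by have := coprime_dvdl qa cop_ab; rewrite prime_coprime // qb.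
Qed.

Section PeriodicCongruence.
Variables (u : nat -> int) (k : nat).
Hypotheses (k_gt0 : 0 < k) (u_periodic : forall m, 0 < m -> u (m + k) = u m)
  (u_prime : forall q m, prime q -> 0 < m -> (q%:Z %| (u (q * m)%N - u m)%R)%Z).

Lemma periodic_bounded : exists B, forall m, 0 < m -> `|u m| <= B.
Proof.
exists (\max_(i < k.+1) `|u i|) => m.
elim/ltn_ind: m => m IHm m_gt0; case: (leqP m k) => [mk | km].
  exact: (@leq_bigmax _ (fun i : 'I_k.+1 => `|u i|) (Ordinal (mk : m < k.+1))).
by rewrite -(subnK (ltnW km)) u_periodic ?subn_gt0 //; apply: IHm; lia.
Qed.

Lemma periodic_addMn m t : 0 < m -> u (m + k * t) = u m.
Proof.
move=> m_gt0; elim: t => [|t IHt]; first by rewrite muln0 addn0.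
by rewrite mulnS addnCA [k + _]addnC u_periodic ?IHt // addn_gt0 m_gt0.
Qed.

(* Two values of u that are congruent modulo a prime exceeding 2B are equal. *)
Lemma periodic_rough B s m : (forall i, 0 < i -> `|u i| <= B) ->
  0 < m -> 0 < s -> (forall q, prime q -> q %| s -> 2 * B < q) ->
  u (s * m) = u m.
Proof.
move=> u_le_B m_gt0; elim/ltn_ind: s => s IHs s_gt0 s_rough.
case: (ltngtP s 1) => [||->]; [lia | move=> s_gt1 | by rewrite mul1n].
have q_pr := pdiv_prime s_gt1; set q := pdiv s in q_pr.
have /dvdnP[t s_eq] : q %| s := pdiv_dvd s.
have t_gt0 : 0 < t by lia.
have <- : u (t * m) = u m.
  apply: IHs => //; first by rewrite s_eq ltn_Pmulr ?prime_gt1.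
  by move=> q' q'_pr q't; apply: s_rough => //; rewrite s_eq dvdn_mulr.
rewrite s_eq (mulnC t) -mulnA.
have tm_gt0 : 0 < t * m by rewrite muln_gt0 t_gt0.
have qB : 2 * B < q by apply: s_rough => //; rewrite s_eq dvdn_mull.
have /dvdzP[w] := u_prime q_pr tm_gt0.
have := u_le_B _ tm_gt0; have := u_le_B (q * (t * m)).
rewrite muln_gt0 tm_gt0 prime_gt0 // => /(_ isT).
move: (u _) (u _) => x y xB yB xy.
suff : w = 0%R by lia.
nia.
Qed.

Lemma periodic_gcdn l : 0 < l -> u l = u (gcdn l k).
Proof.
move=> l_gt0; have [B u_le_B] := periodic_bounded.
have g_gt0 : 0 < gcdn l k by rewrite gcdn_gt0 l_gt0.
set g := gcdn l k in g_gt0 *.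
have /dvdnP[a l_eq] : g %| l := dvdn_gcdl l k.
have /dvdnP[b k_eq] : g %| k := dvdn_gcdr l k.
have cop_ab : coprime a b.
  by rewrite /coprime -(eqn_pmul2r g_gt0) mul1n muln_gcdl -l_eq -k_eq.
have a_gt0 : 0 < a by lia.
have [t t_rough] := exists_rough_addn (2 * B) a_gt0 cop_ab.
rewrite -(periodic_rough u_le_B g_gt0 _ t_rough) ?addn_gt0 ?a_gt0 //.
by rewrite mulnDl -l_eq mulnAC -k_eq periodic_addMn.
Qed.

End PeriodicCongruence.

Lemma short_divisors_bound p k : 1 < p -> 2 < k ->
    (forall l, 0 < l -> l < k -> l * p <= k -> l %| k) ->
  k < if odd k then 2 * p else 2 * p ^ 2.
Proof.
move=> p_gt1 k_gt2 short_dvd.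
case: ifP => k_odd; rewrite ltnNge; apply/negP => k_large.
  by have := short_dvd 2 isT k_gt2 k_large; rewrite dvdn2 k_odd.
pose L := k %/ p.
have Lp : L * p <= k := leq_divM k p.
have k_lt : k < L.+1 * p by apply: ltn_ceil; lia.
have L_ge : 2 * p <= L by rewrite leq_divRL; [nia | lia].
have L_dvd : L %| k by apply: short_dvd => //; nia.
have L1_dvd : L.-1 %| k by apply: short_dvd; nia.
have : L * L.-1 %| k.
  by rewrite Gauss_dvd ?L_dvd // -{1}[L]prednK ?coprimeSn //; lia.
move/(dvdn_leq (ltnW (ltnW k_gt2))); nia.
Qed.

(** * Sums over a finite type *)

Section FiniteSums.
Variable T : finType.
Implicit Types (s : {perm T}) (F : T -> nat).

Lemma leq_sum2 F i j : i != j -> F i + F j <= \sum_l F l.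
Proof.
by move=> ij; rewrite (bigD1 i) //= (bigD1 j) 1?eq_sym //= addnA leq_addr.
Qed.

Lemma sum_excess1 F : (forall x, 0 < F x) -> \sum_x F x = #|T|.+1 ->
  exists y, forall x, F x = 1 + (y == x).
Proof.
move=> F_gt0 sumF; have : \sum_x (F x).-1 == 1.
  rewrite -(eqn_add2l #|T|) addn1 -sumF -sum1_card -big_split /=.
  by apply/eqP/eq_bigr => x _; have := F_gt0 x; lia.
case/sum_nat_eq1 => y [_ Fy Fn]; exists y => x.
by have := F_gt0 x; case: eqVneq => [<- | /[1!eq_sym] /Fn/(_ isT)]; lia.
Qed.

Lemma perm_invariant_support s F : (forall i, F (s i) = F i) ->
  \sum_i F i <= 1 -> forall i, 0 < F i -> s i = i.
Proof.
move=> Fs sumF i Fi; apply/eqP; apply: contraTT sumF => si.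
by rewrite -ltnNge (leq_trans _ (leq_sum2 F si)) // Fs; lia.
Qed.

Lemma sum_fixed s F : (forall i, F (s i) = F i) -> \sum_i F i <= 1 ->
  \sum_(i | s i == i) F i = \sum_i F i.
Proof.
move=> Fs sumF; rewrite [RHS](bigID (fun i => s i == i)) /=.
rewrite [X in _ + X]big1 ?addn0 // => i si; apply/eqP; rewrite -leqn0 leqNgt.
by apply: contra si => Fi; rewrite (perm_invariant_support Fs sumF Fi).
Qed.

Lemma exchange_sum_fixed s (G : T -> T -> nat) :
    (forall i j, G (s i) (s j) = G i j) ->
    (forall i, \sum_j G i j <= 1) -> (forall j, \sum_i G i j <= 1) ->
  \sum_(i | s i == i) \sum_j G i j = \sum_(j | s j == j) \sum_i G i j.
Proof.
move=> Gs row_le1 col_le1.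
transitivity (\sum_(i | s i == i) \sum_(j | s j == j) G i j).
  apply: eq_bigr => i /eqP si; rewrite sum_fixed // => j.
  by rewrite -{1}si Gs.
rewrite exchange_big /=; apply: eq_bigr => j /eqP sj.
rewrite (sum_fixed (s := s) (F := fun i => G i j)) // => i.
by rewrite -{1}sj Gs.
Qed.

End FiniteSums.

(** * Matrices of natural numbers *)

Lemma expmx_eigen (R : comPzSemiRingType) n (A : 'M[R]_n) (v : 'cV_n) a l :
  (A *m v = a *: v)%R -> (A ^+ l *m v = a ^+ l *: v)%R.
Proof.
move=> Av; elim: l => [|l IHl]; first by rewrite !expr0 scale1r mul1mx.
by rewrite exprSr -mulmxE -mulmxA Av -scalemxAr IHl scalerA -exprS.
Qed.

Lemma trmxX (R : comPzSemiRingType) n (A : 'M[R]_n) l :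
  ((A ^+ l)^T = A^T ^+ l)%R.
Proof.
elim: l => [|l IHl]; first by rewrite !expr0 trmx1.
by rewrite exprS exprSr -!mulmxE trmx_mul IHl.
Qed.

Section NatMatrices.
Local Open Scope ring_scope.

Lemma mulmx_natE m n p (A : 'M[nat]_(m, n)) (B : 'M_(n, p)) i j :
  (A *m B) i j = (\sum_h A i h * B h j)%N.
Proof. by rewrite mxE. Qed.

Lemma addmx_natE m n (A B : 'M[nat]_(m, n)) i j :
  (A + B) i j = (A i j + B i j)%N.
Proof. by rewrite mxE. Qed.

Lemma summx_natE m n (I : finType) (A : I -> 'M[nat]_(m, n)) i j :
  (\sum_l A l) i j = (\sum_l A l i j)%N.
Proof. exact: summxE. Qed.

Lemma expmx0_natE n (A : 'M[nat]_n) i j : (A ^+ 0) i j = (i == j).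
Proof. by rewrite mxE; case: (i == j). Qed.

Lemma addmx_natI m n : right_injective (@GRing.add 'M[nat]_(m, n)).
Proof.
move=> A B C /matrixP ABC; apply/matrixP => i j.
by have := ABC i j; rewrite !addmx_natE => /addnI.
Qed.

Lemma mulmx_nat_gt0P m n p (A : 'M[nat]_(m, n)) (B : 'M_(n, p)) i j :
  reflect (exists2 h, 0 < A i h & 0 < B h j)%N (0 < (A *m B) i j)%N.
Proof.
rewrite mulmx_natE lt0n sum_nat_eq0 negb_forall.
apply: (iffP existsP) => [] [h].
  by rewrite -lt0n muln_gt0 => /andP[]; exists h.
by move=> Aih Bhj; exists h; rewrite -lt0n muln_gt0 Aih.
Qed.

Lemma expmx_nat_gt0D n (A : 'M[nat]_n) a b i h j :
  (0 < (A ^+ a) i h -> 0 < (A ^+ b) h j -> 0 < (A ^+ (a + b)) i j)%N.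
Proof. by move=> Aa Ab; rewrite exprD; apply/mulmx_nat_gt0P; exists h. Qed.

Lemma leq_expmx_nat n (A B : 'M[nat]_n) : (forall i j, A i j <= B i j)%N ->
  forall l i j, ((A ^+ l) i j <= (B ^+ l) i j)%N.
Proof.
move=> AB; elim=> [|l IHl] i j //.
by rewrite !exprS !mulmx_natE leq_sum // => h _; rewrite leq_mul.
Qed.

Lemma mulmx_const1 n p (A : 'M[nat]_n) d : (forall i, \sum_j A i j = d)%N ->
  A *m const_mx 1 = const_mx d :> 'M_(n, p).
Proof.
move=> row_sum; apply/matrixP => i j; rewrite mulmx_natE mxE -(row_sum i).
by apply: eq_bigr => h _; rewrite mxE muln1.
Qed.

Lemma mul_const1_mx n p (A : 'M[nat]_n) d : (forall j, \sum_i A i j = d)%N ->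
  const_mx 1 *m A = const_mx d :> 'M_(p, n).
Proof.
move=> col_sum; apply/matrixP => i j; rewrite mulmx_natE mxE -(col_sum j).
by apply: eq_bigr => h _; rewrite mxE mul1n.
Qed.

Lemma sum_row_expmx n (A : 'M[nat]_n) d l : (forall i, \sum_j A i j = d)%N ->
  forall i, (\sum_j (A ^+ l) i j = d ^ l)%N.
Proof.
move=> row_sum i; have A1 : A *m const_mx 1 = d *: const_mx 1 :> 'cV_n.
  by rewrite (mulmx_const1 _ row_sum) scalemx_const mulr1.
have /matrixP/(_ i ord0) := expmx_eigen l A1.
rewrite mulmx_natE !mxE natrME muln1 natrXE => <-.
by apply: eq_bigr => j _; rewrite mxE muln1.
Qed.

Lemma sum_col_expmx n (A : 'M[nat]_n) d l : (forall j, \sum_i A i j = d)%N ->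
  forall j, (\sum_i (A ^+ l) i j = d ^ l)%N.
Proof.
move=> col_sum j; have trmx_row i : (\sum_h A^T i h = d)%N.
  by rewrite -(col_sum i); apply: eq_bigr => h _; rewrite mxE.
rewrite -(sum_row_expmx l trmx_row j).
by apply: eq_bigr => i _; rewrite -trmxX mxE.
Qed.

Lemma exists_const1D_perm_mx n (S : 'M[nat]_n) :
    (forall i j, 0 < S i j)%N -> (forall i, \sum_j S i j = n.+1)%N ->
    (forall j, \sum_i S i j = n.+1)%N ->
  exists s, S = const_mx 1 + perm_mx s.
Proof.
move=> S_gt0 row_sum col_sum.
have [f Sf] : exists f : 'I_n -> 'I_n, forall i j, S i j = (1 + (f i == j))%N.
  apply: (@fin_all_exists _ (fun=> 'I_n)
                          (fun i y => forall j, S i j = (1 + (y == j))%N)) => i.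
  by apply: sum_excess1; rewrite ?card_ord.
have fiber_card j : (\sum_i (f i == j) = 1)%N.
  apply/eqP; rewrite -(eqn_add2l n) addn1 -(col_sum j) -{1}(card_ord n).
  rewrite -sum1_card -big_split /=.
  by apply/eqP/eq_bigr => i _; rewrite Sf.
have f_inj : injective f.
  move=> i i' fii'; apply/eqP; apply: contraT => ii'.
  have := leq_sum2 (fun h => f h == f i : nat) ii'.
  by rewrite fiber_card fii' eqxx.
exists (perm f_inj); apply/matrixP => i j.
by rewrite addmx_natE Sf !mxE permE !natrE.
Qed.

End NatMatrices.

Section PermutationMatrices.
Local Open Scope ring_scope.
Variables (R : pzSemiRingType) (n : nat).
Implicit Types (s : 'S_n) (A : 'M[R]_n).

Lemma comm_perm_mxP s A :
  GRing.comm (perm_mx s) A <-> forall i j, A (s i) (s j) = A i j.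
Proof.
have -> : GRing.comm (perm_mx s) A <-> row_perm s A = col_perm s^-1 A.
  by rewrite row_permE col_permE invgK.
split=> [/matrixP sA i j | sA]; first by have := sA i (s j); rewrite !mxE permK.
by apply/matrixP => i j; rewrite !mxE -(permKV s j) sA permKV.
Qed.

Lemma perm_mxX s m : perm_mx (s ^+ m)%g = perm_mx s ^+ m :> 'M[R]_n.
Proof.
by elim: m => [|m IHm]; rewrite ?perm_mx1 // expgS exprS perm_mxM IHm.
Qed.

Lemma comm_perm_mxX s A l m : GRing.comm (perm_mx s) A ->
  GRing.comm (perm_mx (s ^+ l)%g) (A ^+ m).
Proof.
by move=> sA; rewrite perm_mxX; apply/commrX/commr_sym/commrX/commr_sym.
Qed.

Definition froot_mx s : 'M[R]_n := rowsub (froot s) 1%:M.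

Lemma mul_froot_mx_invariant m s (B : 'M[R]_(n, m)) : perm_mx s *m B = B ->
  froot_mx s *m B = B.
Proof.
rewrite -row_permE -rowsubE => /matrixP sB; apply/matrixP => i j.
rewrite mxE -(iter_findex (connect_root (frel s) i)).
by elim: (findex _ _ _) => //= a IHa; rewrite -IHa -[RHS]sB mxE.
Qed.

Lemma froot_perm s i : froot s (s i) = froot s i.
Proof.
apply/eqP; rewrite eq_sym (root_connect (fconnect_sym (@perm_inj _ s))).
exact: fconnect1.
Qed.

Lemma mul_perm_froot_mx s : perm_mx s *m froot_mx s = froot_mx s.
Proof.
by rewrite -row_permE; apply/matrixP => i j; rewrite !mxE froot_perm.
Qed.

(* If s is an automorphism of A, then A *m froot_mx s is the adjacency matrix of
   the quotient of A by s, each orbit being represented by its root; the rows of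
   the other vertices are copies, which does not change the traces of powers. *)
Lemma exp_mul_froot_mx s A l : GRing.comm (perm_mx s) A ->
  (A *m froot_mx s) ^+ l.+1 = A ^+ l.+1 *m froot_mx s.
Proof.
move=> sA; elim: l => [|l IHl]; first by rewrite !expr1.
have froot_absorbed :
    froot_mx s *m (A ^+ l.+1 *m froot_mx s) = A ^+ l.+1 *m froot_mx s.
  apply: mul_froot_mx_invariant.
  by rewrite mulmxA !mulmxE (commrX l.+1 sA) -!mulmxE -mulmxA mul_perm_froot_mx.
by rewrite exprS IHl -mulmxE -mulmxA froot_absorbed mulmxA mulmxE -exprS.
Qed.

End PermutationMatrices.

Arguments froot_mx {R n} s.

(** * Traces of quotients *)

Section QuotientTraces.
Local Open Scope ring_scope.
Variables (n k c : nat) (B : 'M[nat]_n) (s : 'S_n) (x : 'cV[nat]_n).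
Hypotheses (k_gt0 : (0 < k)%N) (sB : GRing.comm (perm_mx s) B)
  (sx : perm_mx s *m x = x) (Bx : B *m x = c *: x)
  (sum_expB : \sum_(l < k) B ^+ l.+1 + diag_mx x^T =
     x *m x^T + diag_mx x^T *m perm_mx s)
  (norm_x : \tr (x *m x^T) = (\sum_(l < k) c ^ l.+1)%N).
Local Notation quotient := (B *m froot_mx s).

Lemma sum_exp_quotient m :
  \sum_(l < k) quotient ^+ (m + l.+1) = c ^+ m *: (x *m x^T *m froot_mx s).
Proof.
have window : \sum_(l < k) B ^+ l.+1 *m froot_mx s = x *m x^T *m froot_mx s.
  apply: (@addmx_natI _ _ (diag_mx x^T *m froot_mx s)).
  rewrite -mulmx_suml ![diag_mx _ *m _ + _]addrC -mulmxDl sum_expB mulmxDl.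
  by rewrite -(mulmxA (diag_mx _)) mul_perm_froot_mx.
under eq_bigr => l _ do
  rewrite addnS exp_mul_froot_mx // -addnS exprD -mulmxE -mulmxA.
by rewrite -mulmx_sumr window !mulmxA (expmx_eigen _ Bx) !scalemxAl.
Qed.

Lemma sum_mxtrace_quotient m :
  \sum_(l < k) \tr (quotient ^+ (m + l.+1)) =
  (\sum_(l < k) c ^ (m + l.+1))%N.
Proof.
have trace_froot : \tr (x *m x^T *m froot_mx s) = \tr (x *m x^T).
  rewrite -mulmxA mxtrace_mulC -mulmxA mul_froot_mx_invariant //.
  exact: mxtrace_mulC.
rewrite -(raddf_sum (@mxtrace _ n)) sum_exp_quotient /= mxtraceZ trace_froot.
rewrite norm_x natrXE natrME big_distrr /=.
by apply: eq_bigr => l _; rewrite expnD.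
Qed.

Lemma mxtrace_quotient_gcdn l : (0 < l)%N ->
  (\tr (quotient ^+ l))%:Z - (c ^ l)%:Z =
  (\tr (quotient ^+ gcdn l k))%:Z - (c ^ gcdn l k)%:Z.
Proof.
pose u m := ((\tr (quotient ^+ m))%:Z - (c ^ m)%:Z)%R.
apply: (periodic_gcdn (u := u) k_gt0) => [|q m q_pr _].
  apply: window_sum_periodic => m; rewrite /u sumrB; apply/eqP.
  rewrite subr_eq0 -!(big_morph Posz PoszD (erefl 0%R)).
  by rewrite -sum_mxtrace_quotient.
have -> : u (q * m)%N - u m =
    (\tr (quotient ^+ (q * m)))%:Z - (\tr (quotient ^+ m))%:Z -
    ((c ^ (q * m))%:Z - (c ^ m)%:Z) by rewrite /u; lia.
rewrite mulnC exprM expnM; apply: rpredB; rewrite -eqz_mod_dvd !modz_nat.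
  by rewrite mxtrace_exp_prime.
by rewrite fermat_little.
Qed.

End QuotientTraces.

(** * The repeat automorphism *)

Section MooreMatrix.
Variables (n d k : nat) (A : 'M[nat]_n) (r : 'S_n).
Hypotheses (d_gt1 : 1 < d) (k_gt2 : 2 < k) (A_le1 : forall i j, A i j <= 1)
  (row_sumA : forall i, \sum_j A i j = d)
  (col_sumA : forall j, \sum_i A i j = d)
  (sum_expA : (\sum_(l < k.+1) A ^+ l = const_mx 1 + perm_mx r)%R).

Lemma sum_walksE i j : \sum_(l < k.+1) (A ^+ l)%R i j = 1 + (r i == j).
Proof. by rewrite -summx_natE sum_expA addmx_natE !mxE !natrE. Qed.

Lemma sum_pos_walksE i j :
  (\sum_(l < k) A ^+ l.+1)%R i j + (i == j) = 1 + (r i == j).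
Proof. by rewrite -sum_walksE big_ord_recl expmx0_natE summx_natE addnC. Qed.

Lemma sum_pos_walks1 i j :
  (r i == j) = (i == j) -> (\sum_(l < k) A ^+ l.+1)%R i j = 1.
Proof. by move=> rij; have := sum_pos_walksE i j; rewrite rij => /addIn. Qed.

Lemma two_walks a b i j : a < b -> b <= k ->
  0 < (A ^+ a)%R i j -> 0 < (A ^+ b)%R i j -> r i = j.
Proof.
move=> ab bk walk_a walk_b; apply/eqP.
have [a_lt b_lt] : a < k.+1 /\ b < k.+1 by lia.
have ab_neq : Ordinal a_lt != Ordinal b_lt by rewrite -val_eqE /= ltn_eqF.
have := leq_sum2 (fun l : 'I_k.+1 => (A ^+ l)%R i j) ab_neq.
rewrite sum_walksE /=; case: (r i == j) => //.
by rewrite leqNgt (leq_add walk_a walk_b).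
Qed.

Lemma closed_walk_repeat l i :
  0 < l -> l <= k -> 0 < (A ^+ l)%R i i -> r i = i.
Proof.
by move=> l_gt0 lk; apply: two_walks l_gt0 lk _; rewrite expmx0_natE eqxx.
Qed.

Lemma no_short_closed_walk l i : 0 < l -> l < k -> (A ^+ l)%R i i = 0.
Proof.
move=> l_gt0 lk; apply/eqP; rewrite -leqn0 leqNgt; apply/negP => walk_l.
have ri := closed_walk_repeat l_gt0 (ltnW lk) walk_l.
have [j ji Aij] : exists2 j, j != i & 0 < A i j.
  apply/exists_inP; apply: contraTT d_gt1 => /exists_inPn noA.
  rewrite -leqNgt -(row_sumA i) (bigD1 i) //= big1 ?addn0 // => j ji.
  by apply/eqP; rewrite -leqn0 leqNgt noA.
have walk_l1 : 0 < (A ^+ (l + 1))%R i j.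
  by apply: expmx_nat_gt0D walk_l _; rewrite expr1.
have rij : r i = j.
  by apply: (two_walks (a := 1)) walk_l1; rewrite ?expr1 ?addn1.
by rewrite -rij ri eqxx in ji.
Qed.

Lemma no_loop i : A i i = 0.
Proof. by rewrite -(@no_short_closed_walk 1 i) ?expr1 //; lia. Qed.

Lemma repeat_comm : GRing.comm (perm_mx r) A.
Proof.
apply/esym/(@addmx_natI _ _ (const_mx d)).
rewrite -{1}(mulmx_const1 _ row_sumA) -(mul_const1_mx _ col_sumA) -!mulmxE.
rewrite -mulmxDr -mulmxDl -sum_expA.
by apply: commr_sum => l _; apply: commrX.
Qed.

Lemma walks_repeatX p l i j :
  (A ^+ l)%R ((r ^+ p)%g i) ((r ^+ p)%g j) = (A ^+ l)%R i j.
Proof. by move: i j; apply/comm_perm_mxP/comm_perm_mxX/repeat_comm. Qed.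

Lemma arcs_repeatX p i j : A ((r ^+ p)%g i) ((r ^+ p)%g j) = A i j.
Proof. by have := walks_repeatX p 1 i j; rewrite expr1. Qed.

(* Both sides count the walks of length at most k+1 from u to v whose
   vertices next to u and to v are fixed: every such walk is determined by
   its first step and also by its last one. *)
Lemma fixed_degree_transfer p u v :
    (r ^+ p)%g u = u -> r v = v -> A u v = 0 ->
  \sum_(i | (r ^+ p)%g i == i) A u i = \sum_(j | (r ^+ p)%g j == j) A j v.
Proof.
move=> ru rv Auv; pose W := (\sum_(l < k) A ^+ l)%R.
have mulAW : (A *m W = \sum_(l < k) A ^+ l.+1)%R.
  by rewrite mulmx_sumr; apply: eq_bigr => l _; rewrite exprS.
have mulWA : (W *m A = \sum_(l < k) A ^+ l.+1)%R.
  by rewrite mulmx_suml; apply: eq_bigr => l _; rewrite exprSr.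
pose G i j := A u i * W i j * A j v.
have sumG_row i : \sum_j G i j = A u i.
  rewrite /G; under eq_bigr do rewrite -mulnA.
  rewrite -big_distrr -mulmx_natE mulWA /= sum_pos_walks1 ?muln1 //.
  by rewrite -{1}rv (inj_eq perm_inj).
have sumG_col j : \sum_i G i j = A j v.
  rewrite /G -big_distrl -mulmx_natE mulAW /=.
  case: (posnP (A j v)) => [-> | Ajv]; first exact: muln0.
  have /negPf uj : u != j by apply: contraTneq Ajv => <-; rewrite Auv.
  have /negPf ruj : r u != j.
    apply: contraTneq Ajv => <-; rewrite -{1}rv.
    by have := arcs_repeatX 1 u v; rewrite !expg1 => ->; rewrite Auv.
  by rewrite sum_pos_walks1 ?uj ?ruj // mul1n.
have Gr i j : G ((r ^+ p)%g i) ((r ^+ p)%g j) = G i j.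
  rewrite /G -{1}ru -{1}(permX_fix p rv) !arcs_repeatX /W !summx_natE.
  by under eq_bigr do rewrite walks_repeatX.
under eq_bigr do rewrite -sumG_row.
under [RHS]eq_bigr do rewrite -sumG_col.
by apply: exchange_sum_fixed => // i; rewrite ?sumG_row ?sumG_col.
Qed.

Variable z : 'I_n.
Hypotheses (rz : r z = z) (closed_walk_z : 0 < (A ^+ k)%R z z).

Lemma walks_self_repeat_le1 l j : l <= k -> (A ^+ l)%R z j <= 1.
Proof.
move=> lk; have lk1 : l < k.+1 by [].
have := sum_walksE z j; rewrite rz; case: (eqVneq z j) => [<- | zj] sum_z.
  case: (posnP l) => [-> | l_gt0]; first by rewrite expmx0_natE eqxx.
  have l_neq0 : ord0 != Ordinal lk1 by rewrite -val_eqE /= ltn_eqF.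
  have := leq_sum2 (fun l : 'I_k.+1 => (A ^+ l)%R z z) l_neq0.
  by rewrite sum_z /= expmx0_natE eqxx.
by rewrite -[1]sum_z (bigD1 (Ordinal lk1)) //= leq_addr.
Qed.

Lemma fixed_walk_midpoint p l i j : (r ^+ p)%g j = j -> l < k ->
  0 < (A ^+ l)%R z i -> 0 < A i j -> (r ^+ p)%g i = i.
Proof.
move=> rj lk Azi Aij.
apply: (perm_invariant_support (F := fun h => (A ^+ l)%R z h * A h j)).
- by move=> h; rewrite -{1}(permX_fix p rz) walks_repeatX -{1}rj arcs_repeatX.
- by rewrite -mulmx_natE mulmxE -exprSr walks_self_repeat_le1.
by rewrite muln_gt0 Azi.
Qed.

Lemma fixed_out_neighbour : exists2 y, 0 < A z y & r y = y.
Proof.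
have [y] : exists2 y, 0 < A z y & 0 < (A ^+ k.-1)%R y z.
  by apply/mulmx_nat_gt0P; rewrite mulmxE -exprS prednK //; lia.
move=> Azy Ayz; exists y => //.
apply: (perm_invariant_support (F := fun h => A z h * (A ^+ k.-1)%R h z)).
- move=> h; have := walks_repeatX 1 k.-1 h z; have := arcs_repeatX 1 z h.
  by rewrite !expg1 rz => -> ->.
- rewrite -mulmx_natE mulmxE -exprS prednK ?walks_self_repeat_le1 //; lia.
by rewrite muln_gt0 Azy.
Qed.

(** * Fixed subdigraphs of powers of the repeat automorphism *)

Definition fixed_degree p := \sum_(j | (r ^+ p)%g j == j) A z j.

Section FixedSubdigraph.
Variable p : nat.
Local Notation fixed i := ((r ^+ p)%g i == i).
Local Notation c := (fixed_degree p).

Lemma fixed_regular i : fixed i -> \sum_(j | fixed j) A i j = c.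
Proof.
move=> /eqP ri; have [y Azy ry] := fixed_out_neighbour.
have Ayz : A y z = 0.
  apply/eqP; rewrite -leqn0 leqNgt; apply/negP => Ayz.
  have : 0 < (A ^+ (1 + 1))%R z z.
    by apply: (expmx_nat_gt0D (h := y)); rewrite expr1.
  by rewrite no_short_closed_walk.
have in_z : \sum_(j | fixed j) A j z = c.
  by rewrite -(fixed_degree_transfer (permX_fix p rz) rz) ?no_loop.
have in_y : \sum_(j | fixed j) A j y = c.
  rewrite -(fixed_degree_transfer (permX_fix p ry) ry) ?no_loop //.
  by rewrite (fixed_degree_transfer (permX_fix p ry) rz).
case: (posnP (A i z)) => [Aiz | Aiz].
  by rewrite (fixed_degree_transfer ri rz).
case: (posnP (A i y)) => [Aiy | Aiy].
  by rewrite (fixed_degree_transfer ri ry).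
have walk2 : 0 < (A ^+ (1 + 1))%R i y.
  by apply: (expmx_nat_gt0D (h := z)); rewrite expr1.
have riy : r i = r y.
  by rewrite ry; apply: (two_walks (a := 1)) walk2; rewrite ?expr1 //; lia.
by rewrite (perm_inj riy) Ayz in Aiz.
Qed.

Definition fixed_mx : 'M[nat]_n :=
  \matrix_(i, j) if fixed i && fixed j then A i j else 0.

Definition fixed_col : 'cV[nat]_n := \col_i nat_of_bool (fixed i).

Local Notation B := fixed_mx.
Local Notation x := fixed_col.

Lemma leq_exp_fixed_mx l i j : (B ^+ l)%R i j <= (A ^+ l)%R i j.
Proof. by apply: leq_expmx_nat => h h'; rewrite mxE; case: ifP. Qed.

Lemma exp_fixed_mx_out l i j :
  ~~ (fixed i && fixed j) -> (B ^+ l.+1)%R i j = 0.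
Proof.
case/nandP => [/negPf fi | /negPf fj].
  by rewrite exprS mulmx_natE big1 // => h _; rewrite mxE fi mul0n.
rewrite exprSr mulmx_natE big1 // => h _.
by rewrite [fixed_mx _ _]mxE fj andbF muln0.
Qed.

Lemma fixed_repeat i : fixed (r i) = fixed i.
Proof. by rewrite -permM -expgS expgSr permM (inj_eq perm_inj). Qed.

Lemma repeat_fixed_mx : GRing.comm (perm_mx r) B.
Proof.
apply/comm_perm_mxP => i j; rewrite !mxE !fixed_repeat.
by have := arcs_repeatX 1 i j; rewrite expg1 => ->.
Qed.

Lemma repeat_fixed_col : (perm_mx r *m x = x)%R.
Proof. by apply/matrixP => i j; rewrite -row_permE !mxE fixed_repeat. Qed.

Lemma sum_mul_fixed_col (F : 'I_n -> nat) j :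
  \sum_i F i * x i j = \sum_(i | fixed i) F i.
Proof.
rewrite [RHS]big_mkcond; apply: eq_bigr => i _; rewrite mxE.
by case: ifP; rewrite ?muln0 ?muln1.
Qed.

Lemma fixed_mx_eigen : (B *m x = c *: x)%R.
Proof.
apply/matrixP => i j; rewrite mulmx_natE sum_mul_fixed_col !mxE natrME.
case: (boolP (fixed i)) => fi; rewrite ?muln1 ?muln0; last first.
  by rewrite big1 // => h _; rewrite mxE (negPf fi).
by rewrite -(fixed_regular fi); apply: eq_bigr => h fh; rewrite mxE fi fh.
Qed.

Lemma sum_exp_fixed_mx l i :
  fixed i -> \sum_(j | fixed j) (B ^+ l)%R i j = c ^ l.
Proof.
move=> fi; have /matrixP/(_ i ord0) := expmx_eigen l fixed_mx_eigen.
by rewrite mulmx_natE sum_mul_fixed_col !mxE fi natrME muln1.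
Qed.

Lemma exp_fixed_mx_self_repeat l j : l <= k -> fixed j ->
  (B ^+ l)%R z j = (A ^+ l)%R z j.
Proof.
elim: l j => [|l IHl] j lk fj; first by rewrite !expmx0_natE.
rewrite !exprSr !mulmx_natE; apply: eq_bigr => i _.
case: (boolP (fixed i)) => fi; first by rewrite IHl 1?ltnW // mxE fi fj.
rewrite mxE (negPf fi) muln0; apply/esym/eqP; apply: contraNT fi.
rewrite -lt0n muln_gt0 => /andP[Azi Aij]; apply/eqP.
exact: (fixed_walk_midpoint (eqP fj) lk Azi Aij).
Qed.

Lemma card_fixed : \sum_(j | fixed j) 1 = \sum_(l < k) c ^ l.+1.
Proof.
have fz : fixed z by rewrite permX_fix.
under [RHS]eq_bigr do rewrite -(sum_exp_fixed_mx _ fz).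
rewrite exchange_big /=; apply: eq_bigr => j fj.
rewrite -(sum_pos_walks1 (_ : (r z == j) = (z == j))) ?rz // summx_natE.
by apply: eq_bigr => l _; rewrite exp_fixed_mx_self_repeat.
Qed.

(* The left-hand side counts fewer walks than [sum_pos_walksE], but the totals
   over all fixed j agree. *)
Lemma sum_pos_walks_fixedE i j : fixed i -> fixed j ->
  (\sum_(l < k) B ^+ l.+1)%R i j + (i == j) = 1 + (r i == j).
Proof.
move=> fi fj; rewrite -sum_pos_walksE; congr (_ + _).
have leBA h : (\sum_(l < k) B ^+ l.+1)%R i h <= (\sum_(l < k) A ^+ l.+1)%R i h.
  by rewrite !summx_natE leq_sum // => l _; apply: leq_exp_fixed_mx.
have sum_delta h : fixed h -> \sum_(j | fixed j) (h == j) = 1.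
  move=> fh; rewrite (bigD1 h) //= eqxx big1 // => j' /andP[_ /negPf].
  by rewrite eq_sym => ->.
have [_] := leqif_sum (fun h (fh : fixed h) => leqif_eq (leBA h)).
suff -> : \sum_(h | fixed h) (\sum_(l < k) B ^+ l.+1)%R i h =
          \sum_(h | fixed h) (\sum_(l < k) A ^+ l.+1)%R i h.
  by rewrite eqxx => /esym/forall_inP/(_ j fj)/eqP.
transitivity (\sum_(h | fixed h) 1).
  under eq_bigr do rewrite summx_natE; rewrite exchange_big card_fixed /=.
  by apply: eq_bigr => l _; apply: sum_exp_fixed_mx.
have : \sum_(h | fixed h) ((\sum_(l < k) A ^+ l.+1)%R i h + (i == h)) =
       \sum_(h | fixed h) (1 + (r i == h)).
  by apply: eq_bigr => h _; apply: sum_pos_walksE.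
by rewrite !big_split /= !sum_delta ?fixed_repeat // => /addIn.
Qed.

Lemma sum_expS_fixed_mx :
  (\sum_(l < k) B ^+ l.+1 + diag_mx x^T =
   x *m x^T + diag_mx x^T *m perm_mx r)%R.
Proof.
apply/matrixP => i j; rewrite mul_diag_mx !addmx_natE mulmx_natE big_ord1 !mxE.
case: (boolP (fixed i && fixed j)) => [/andP[fi fj] | nfij].
  have := sum_pos_walks_fixedE fi fj.
  by rewrite fi fj; case: (i == j); case: (r i == j).
rewrite summx_natE big1 => [|l _]; last exact: exp_fixed_mx_out.
move: nfij; case: (boolP (fixed i)) => fi /= fj.
  have [ij rij] : i != j /\ r i != j.
    by split; apply: contraNneq fj => <-; rewrite ?fixed_repeat.
  by rewrite (negPf ij) (negPf rij) (negPf fj).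
by case: (i == j); case: (r i == j).
Qed.

Lemma mxtrace_fixed_col :
  (\tr (x *m x^T))%R = \sum_(l < k) c ^ l.+1.
Proof.
rewrite -card_fixed [RHS]big_mkcond; apply: eq_bigr => i _.
by rewrite mulmx_natE big_ord1 !mxE; case: ifP.
Qed.

Local Notation quotient := (B *m froot_mx r)%R.

(* A closed walk of length l in the quotient lifts to a walk from i to r^t i.
   Its translates by r^t concatenate, after p steps, to a closed walk of length
   l p <= k; hence r i = i and the lifted walk was itself closed. *)
Lemma mxtrace_quotient_eq0 l : 0 < p -> 0 < l -> l < k -> l * p <= k ->
  (\tr (quotient ^+ l))%R = 0.
Proof.
case: l => // l p_gt0 _ lk lpk; apply: big1 => i _; apply/eqP.
rewrite -leqn0 leqNgt exp_mul_froot_mx; last exact: repeat_fixed_mx.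
apply/negP => /mulmx_nat_gt0P[j Bij]; rewrite !mxE.
case: (eqVneq (froot r j) i) => // ji _.
have fi : fixed i.
  by apply: contraTT Bij => fi; rewrite exp_fixed_mx_out // negb_and fi.
have {Bij} Aij := leq_trans Bij (leq_exp_fixed_mx _ _ _).
have [t jE] : exists t, j = (r ^+ t)%g i.
  have ij : fconnect r i j.
    by rewrite (fconnect_sym (@perm_inj _ r)) -ji; apply: connect_root.
  by exists (findex r i j); rewrite permX iter_findex.
have walk_iter m : 0 < (A ^+ (m * l.+1))%R i ((r ^+ (t * m))%g i).
  elim: m => [|m IHm]; first by rewrite muln0 expmx0_natE perm1 eqxx.
  rewrite mulSn (mulnSr t) expgnDr permM; apply: expmx_nat_gt0D Aij _.
  by rewrite jE walks_repeatX.
have ri : r i = i.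
  apply: (@closed_walk_repeat (p * l.+1)); rewrite ?muln_gt0 ?p_gt0 1?mulnC //.
  by have := walk_iter p; rewrite mulnC (mulnC t) expgM permX_fix // (eqP fi).
by rewrite jE permX_fix // no_short_closed_walk in Aij.
Qed.

Lemma dvdn_short_length l : 0 < p -> 1 < c -> 0 < l -> l < k -> l * p <= k ->
  l %| k.
Proof.
move=> p_gt0 c_gt1 l_gt0 lk lpk.
have gcd_le : gcdn l k <= l by apply: dvdn_leq => //; apply: dvdn_gcdl.
have gcd_gt0 : 0 < gcdn l k by rewrite gcdn_gt0 l_gt0.
have := mxtrace_quotient_gcdn (ltnW (ltnW k_gt2)) repeat_fixed_mx
  repeat_fixed_col fixed_mx_eigen sum_expS_fixed_mx mxtrace_fixed_col l_gt0.
rewrite !mxtrace_quotient_eq0 //; [move=> pow_eq | lia | nia].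
have /eqP : c ^ l = c ^ gcdn l k by lia.
by rewrite eqn_exp2l // => /eqP ->; apply: dvdn_gcdr.
Qed.

End FixedSubdigraph.

Lemma fixed_degree1_le1 : fixed_degree 1 <= 1.
Proof.
rewrite leqNgt; apply/negP => c_gt1.
have : k.-1 %| k by apply: (@dvdn_short_length 1); lia.
rewrite -{2}[k]prednK; last by lia.
by rewrite -addn1 dvdn_addr // dvdn1; lia.
Qed.

Lemma moved_out_neighbour : exists2 i, 0 < A z i & r i != i.
Proof.
apply/exists_inP; apply: contraTT fixed_degree1_le1 => /exists_inPn fixed_out.
rewrite -ltnNge /fixed_degree big_mkcond (leq_trans d_gt1) // -(row_sumA z).
apply: leq_sum => j _; rewrite expg1.
by case: (posnP (A z j)) => [-> // | /fixed_out]; rewrite negbK => ->.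
Qed.

Lemma exists_fixed_degree_gt1 : exists2 p, 1 < p < d & 1 < fixed_degree p.
Proof.
have [y Azy ry] := fixed_out_neighbour.
have [i Azi ri] := moved_out_neighbour.
have yi : y != i by apply: contraNneq ri => <-; rewrite ry.
have orbit_out j : j \in porbit r i -> A z j = 1 /\ j != y.
  case/porbitP => m ->; split.
    apply/eqP; rewrite eqn_leq A_le1 /=.
    by rewrite -{1}(permX_fix m rz) arcs_repeatX.
  by rewrite -(permX_fix m ry) (inj_eq perm_inj) eq_sym.
exists #|porbit r i|.
  apply/andP; split.
    have <- : #|[set i; r i]| = 2 by rewrite cards2 eq_sym ri.
    apply/subset_leq_card/subsetP => j /set2P[] ->; first exact: porbit_id.
    by have := mem_porbit r 1 i; rewrite expg1.
  rewrite -(row_sumA z) (bigD1 y) //= -add1n leq_add // -sum1_card.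
  rewrite big_mkcond [leqRHS]big_mkcond leq_sum // => j _.
  by case: ifP => // /orbit_out[-> ->].
rewrite /fixed_degree big_mkcond (leq_trans _ (leq_sum2 _ yi)) //=.
by rewrite permX_fix // permX iter_porbit !eqxx (leq_add Azy Azi).
Qed.

Lemma self_repeat_diameter_bound : k < if odd k then 2 * d.-1 else 2 * d.-1 ^ 2.
Proof.
have [p /andP[p_gt1 pd] c_gt1] := exists_fixed_degree_gt1.
apply: leq_trans (short_divisors_bound p_gt1 k_gt2 _) _ => [l l_gt0 lk lpk|].
  exact: dvdn_short_length (ltnW p_gt1) c_gt1 l_gt0 lk lpk.
by case: ifP => _; rewrite leq_mul2l /= ?leq_exp2r //; lia.
Qed.

End MooreMatrix.

(** * Adjacency matrices *)

Definition adjacency_mx (T : finType) (e : rel T) : 'M[nat]_#|T| :=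
  \matrix_(i, j) nat_of_bool (e (enum_val i) (enum_val j)).

Lemma sum_bool_card (T : finType) (P : pred T) :
  \sum_x nat_of_bool (P x) = #|[set x | P x]|.
Proof.
by rewrite -sum1dep_card [RHS]big_mkcond; apply: eq_bigr => x _; case: (P x).
Qed.

Section Adjacency.
Variables (T : finType) (e : rel T).

Lemma adjacency_mx_row i :
  \sum_j adjacency_mx e i j = outdeg e (enum_val i).
Proof.
under eq_bigr do rewrite mxE.
rewrite -(big_enum_val (A := T) (fun v => nat_of_bool (e (enum_val i) v))) /=.
exact: sum_bool_card.
Qed.

Lemma adjacency_mx_col j : \sum_i adjacency_mx e i j = indeg e (enum_val j).
Proof.
under eq_bigr do rewrite mxE.
rewrite -(big_enum_val (A := T) (fun v => nat_of_bool (e v (enum_val j)))) /=.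
exact: sum_bool_card.
Qed.

Lemma exp_adjacency_mx l i j :
  (adjacency_mx e ^+ l)%R i j = num_walks e l (enum_val i) (enum_val j).
Proof.
rewrite /num_walks -sum_bool_card; elim: l i => [|l IHl] i.
  rewrite expmx0_natE (bigD1 [tuple]) //= big1 => [|t].
    by rewrite addn0 /walk /= (inj_eq enum_val_inj).
  by rewrite [t]tuple0 => /eqP[].
pose cons_walk (w : T * l.-tuple T) : l.+1.-tuple T := [tuple of w.1 :: w.2].
have cons_walk_bij : bijective cons_walk.
  exists (fun t => (thead t, [tuple of behead t])) => [[v t] | t].
    by congr (_, _); apply: val_inj.
  by case/tupleP: t => v t; apply: val_inj.
rewrite (reindex cons_walk) /=; last exact: onW_bij.
rewrite -(pair_bigA _ (fun v t => nat_of_bool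
  (walk e (enum_val i) (enum_val j) (cons_walk (v, t))))) /=.
rewrite exprS mulmx_natE (big_enum_val (A := T)); apply: eq_bigr => h _.
rewrite IHl mxE big_distrr; apply: eq_bigr => t _.
by rewrite /walk /= -andbA mulnb.
Qed.

Lemma almost_moore_repeat d k : almost_moore e d k ->
  exists r, (\sum_(l < k.+1) adjacency_mx e ^+ l = const_mx 1 + perm_mx r)%R.
Proof.
case=> _ _ regular [diam _] cardT.
have sum_pow : \sum_(l < k.+1) d ^ l = #|T|.+1.
  by rewrite big_ord_recl cardT big_add1 big_mkord.
have rows i : \sum_j adjacency_mx e i j = d.
  by rewrite adjacency_mx_row; case: (regular (enum_val i)).
have cols j : \sum_i adjacency_mx e i j = d.
  by rewrite adjacency_mx_col; case: (regular (enum_val j)).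
apply: exists_const1D_perm_mx => [i j|i|j].
- have [l [[w walk_w] _] lk] := diam (enum_val i) (enum_val j).
  rewrite summx_natE (bigD1 (Ordinal (lk : l < k.+1))) //= exp_adjacency_mx.
  by rewrite addn_gt0; apply/orP; left; apply/card_gt0P; exists w; rewrite inE.
- under eq_bigr do rewrite summx_natE; rewrite exchange_big -sum_pow /=.
  by apply: eq_bigr => l _; apply: sum_row_expmx.
under eq_bigr do rewrite summx_natE; rewrite exchange_big -sum_pow /=.
by apply: eq_bigr => l _; apply: sum_col_expmx.
Qed.

End Adjacency.

Theorem theorem3 (d k : nat) (hd : 6 <= d) (hk : 1 < k)
  (h : (odd k /\ 2 * (d - 1) <= k) \/ (~~ odd k /\ 2 * (d - 1) ^ 2 <= k)) :
  ~ exists (T : finType) (e : rel T),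
      almost_moore e d k /\ has_self_repeats e k.
Proof.
case=> T [e [moore [v [two_walks_v closed_walk_v]]]].
have [r sum_exp] := almost_moore_repeat moore.
case: moore => _ _ regular _ _.
have k_gt2 : 2 < k by case: h => [] [_]; nia.
have rv : r (enum_rank v) = enum_rank v.
  have := sum_walksE sum_exp (enum_rank v) (enum_rank v).
  under eq_bigr do rewrite exp_adjacency_mx enum_rankK.
  rewrite -(big_mkord xpredT (fun l => num_walks e l v v)) two_walks_v.
  by case: eqP.
have : k < if odd k then 2 * d.-1 else 2 * d.-1 ^ 2.
  apply: (self_repeat_diameter_bound _ _ _ _ _ sum_exp rv) => //; first by lia.
  - by move=> i j; rewrite mxE leq_b1.
  - by move=> i; rewrite adjacency_mx_row; case: (regular (enum_val i)).
  - by move=> j; rewrite adjacency_mx_col; case: (regular (enum_val j)).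
  by rewrite exp_adjacency_mx enum_rankK.
by case: h => [[->] | [/negPf ->]]; rewrite subn1 leqNgt => /negPf ->.
Qed.
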